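(* Let $\theta>0$ be such that there is at least one $\mathbf a$ with $(\theta,\mathbf a)\in\mathcal D$. In the minimum-variance case, the optimisation problem $$\mathbf a^\star(\theta)=\arg\inf_{\mathbf a:\,(\theta,\mathbf a)\in\mathcal D}\ \frac1\theta\ln\mathbb E\left[\exp(\theta V_{\mathbf a}(\mathbf X))\right]$$ is equivalent to (has the same solution as) $$\mathbf a^\star(\theta)=\arg\inf_{\mathbf a\in\mathcal A}\ \mathbf a^T\Sigma\,\mathbf a .$$ Thus the optimal portfolio in the alternative model is the same as the one in the nominal model, i.e. $\mathbf a^\star(\theta)=\mathbf a_0^\star$.
   Context: Let $n\ge1$, $\boldsymbol\mu\in\mathbb R^n$, $\Sigma\in\mathbb R^{n\times n}$ symmetric positive definite, and let $\mathbf X\sim N(\boldsymbol\mu,\Sigma)$ under the nominal model, with expectation $\mathbb E$. Let $\mathbf 1\in\mathbb R^n$ be the all-ones vector and $\mathcal A=\{\mathbf a\in\mathbb R^n:\mathbf a^T\mathbf 1=1\}$ the set of portfolios. Minimum-variance measure of risk: $V_{\mathbf a}(\mathbf X)=\frac12\,\mathbf a^T(\mathbf X-\boldsymbol\mu)(\mathbf X-\boldsymbol\mu)^T\mathbf a$. Domain (with risk aversion $\gamma=1$ in this case): $\mathcal D=\{(\theta,\mathbf a):\theta>0,\ \mathbf a\in\mathcal A,\ \theta\,\mathbf a^T\Sigma\,\mathbf a<1\}$. $\mathbf a_0^\star=\Sigma^{-1}\mathbf 1/(\mathbf 1^T\Sigma^{-1}\mathbf 1)$ is the minimum-variance portfolio,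 i.e. the optimal portfolio of the nominal problem $\inf_{\mathbf a\in\mathcal A}\mathbb E[V_{\mathbf a}(\mathbf X)]$. *)

(* Defs.v *)
From HB Require Import structures.
From mathcomp Require Import all_boot all_order all_algebra.
From mathcomp Require Import all_classical all_reals all_analysis.

Set Implicit Arguments.
Unset Strict Implicit.
Unset Printing Implicit Defensive.

Import Order.TTheory GRing.Theory Num.Theory.
Import numFieldNormedType.Exports.

Local Open Scope classical_set_scope.
Local Open Scope ring_scope.

Section tuple_cons.
Context {R : realType} {n : nat}.

Definition tuple_cons (p : measurableTypeR R * n.-tuple (measurableTypeR R)) :
  n.+1.-tuple (measurableTypeR R) := [tuple of p.1 :: p.2].

Lemma measurable_tuple_cons : measurable_fun [set: _] tuple_cons.
Proof. exact: measurable_cons. Qed.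

Definition tuple_uncons (x : n.+1.-tuple (measurableTypeR R)) :
  measurableTypeR R * n.-tuple (measurableTypeR R) :=
  (thead x, [tuple of behead x]).

Lemma tuple_consK : cancel tuple_cons tuple_uncons.
Proof. by move=> [a b]; congr pair; apply/val_inj. Qed.

Lemma measurable_tuple_uncons : measurable_fun [set: _] tuple_uncons.
Proof.
by apply: measurable_fun_pair; [exact: measurable_tnth|exact: measurable_behead].
Qed.

End tuple_cons.

Section lebesgue_measure_cons.
Context {R : realType} {n : nat}.
Variable m : {sigma_finite_measure set (n.-tuple (measurableTypeR R)) -> \bar R}.

Definition lebesgue_measure_cons
    : set (n.+1.-tuple (measurableTypeR R)) -> \bar R :=
  pushforward (@lebesgue_measure R \x m)%E tuple_cons.

Let lebesgue_measure_cons0 : lebesgue_measure_cons set0 = 0%E.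
Proof. by rewrite /lebesgue_measure_cons /pushforward preimage_set0 measure0. Qed.

Let lebesgue_measure_cons_ge0 A : (0 <= lebesgue_measure_cons A)%E.
Proof. by rewrite /lebesgue_measure_cons /pushforward measure_ge0. Qed.

Let lebesgue_measure_cons_sigma_additive :
  semi_sigma_additive lebesgue_measure_cons.
Proof.
exact: (@measure_semi_sigma_additive _ _ _
  (measure_function_pushforward__canonical__measure_function_Measure
     (lebesgue_measure \x m)%E measurable_tuple_cons)).
Qed.

HB.instance Definition _ := isMeasure.Build _ _ _ lebesgue_measure_cons
  lebesgue_measure_cons0 lebesgue_measure_cons_ge0
  lebesgue_measure_cons_sigma_additive.

Let lebesgue_measure_cons_sigma_finite : sigma_finite setT lebesgue_measure_cons.
Proof.
have /sigma_finiteP[F [TF ndF Foo]] := sigma_finiteT (@lebesgue_measure R).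
have /sigma_finiteP[G [TG ndG Goo]] := sigma_finiteT m.
exists (fun k => tuple_uncons @^-1` (F k `*` G k)).
  apply/esym; rewrite -subTset => x _.
  have [i _ Fi] : (\bigcup_i F i) (tuple_uncons x).1 by rewrite -TF.
  have [j _ Gj] : (\bigcup_i G i) (tuple_uncons x).2 by rewrite -TG.
  exists (maxn i j) => //; split.
    by move: Fi; exact/subsetPset/ndF/leq_maxl.
  by move: Gj; exact/subsetPset/ndG/leq_maxr.
move=> k; have [mF Fk] := Foo k; have [mG Gk] := Goo k; split.
  rewrite -[X in measurable X]setTI; apply: measurable_tuple_uncons => //.
  exact: measurableX.
rewrite /lebesgue_measure_cons /pushforward -comp_preimage.
rewrite (_ : tuple_uncons \o tuple_cons = id); last first.
  by apply/funext => p; exact: tuple_consK.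
by rewrite preimage_id product_measure1E// lte_mul_pinfty// ge0_fin_numE.
Qed.

HB.instance Definition _ := Measure_isSigmaFinite.Build _ _ _
  lebesgue_measure_cons lebesgue_measure_cons_sigma_finite.

End lebesgue_measure_cons.

(* Lebesgue measure on R^n, the n-fold product of the one-dimensional one. *)
Fixpoint lebesgue_measure_tuple (R : realType) (n : nat) :
    {sigma_finite_measure set (n.-tuple (measurableTypeR R)) -> \bar R} :=
  match n with
  | 0 => \d_([tuple] : 0.-tuple (measurableTypeR R))
  | n'.+1 => lebesgue_measure_cons (lebesgue_measure_tuple R n')
  end.

Lemma lebesgue_measure_tuple_box (R : realType) (n : nat)
    (A : 'I_n -> set (measurableTypeR R)) : (forall i, measurable (A i)) ->
  lebesgue_measure_tuple R n [set x | forall i, A i (tnth x i)] =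
  (\prod_(i < n) lebesgue_measure (A i))%E.
Proof.
elim: n A => [|n ih] A mA.
  rewrite big_ord0 /= diracE mem_set// => -[].
  by [].
rewrite big_ord_recl /= /lebesgue_measure_cons /pushforward.
pose B : set (n.-tuple (measurableTypeR R)) :=
  [set x | forall i, A (lift ord0 i) (tnth x i)].
have mB : measurable B.
  rewrite (_ : B = \bigcap_(i in [set: 'I_n])
     (@tnth n (measurableTypeR R) ^~ i @^-1` A (lift ord0 i))).
    apply: fin_bigcap_measurable; first exact: finite_finset.
    by move=> i _; rewrite -[X in measurable X]setTI; exact: measurable_tnth.
  by apply/seteqP; split => [x h i _|x h i]; [exact: h|exact: (h i I)].
rewrite (_ : _ @^-1` _ = A ord0 `*` B).
  rewrite product_measure1E//; congr (_ * _)%E.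
  exact: (ih (fun i => A (lift ord0 i))).
apply/seteqP; split => [[a x]/= h|[a x]/= [h1 h2] i].
  by split=> [|i]; [exact: (h ord0)|have := h (lift ord0 i); rewrite /tuple_cons tnthS].
by case: (unliftP ord0 i) => [j|] ->; rewrite /tuple_cons ?tnthS.
Qed.

(* Tuples carry the Borel structure of R^n, column vectors the linear algebra. *)
Definition col_of_tuple (R : Type) (n : nat) (x : n.-tuple R) : 'cV[R]_n :=
  \col_i tnth x i.

Definition quad_form (R : realType) (n : nat) (M : 'M[R]_n) (a : 'cV[R]_n) : R :=
  (a^T *m M *m a) 0 0.

Definition posdefmx (R : realType) (n : nat) (M : 'M[R]_n) : Prop :=
  M^T = M /\ forall a : 'cV[R]_n, a != 0 -> 0 < quad_form M a.

Definition mvnormal_pdf (R : realType) (n : nat) (mu : 'cV[R]_n) (Sigma : 'M[R]_n)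
    (x : 'cV[R]_n) : R :=
  expR (- (quad_form (invmx Sigma) (x - mu) / 2)) /
    Num.sqrt ((2 * pi) ^+ n * \det Sigma).

(* X ~ N(mu, Sigma), defined by its density; meant for a positive definite
   Sigma. *)
Definition mvnormal (R : realType) (d : measure_display) (T : measurableType d)
    (P : probability T R) (n : nat)
    (X : {RV P >-> n.-tuple (measurableTypeR R)})
    (mu : 'cV[R]_n) (Sigma : 'M[R]_n) : Prop :=
  forall A, measurable A ->
    distribution P X A =
    (\int[lebesgue_measure_tuple R n]_(x in A)
       (mvnormal_pdf mu Sigma (col_of_tuple x))%:E)%E.

Definition portfolio (R : realType) (n : nat) : set 'cV[R]_n :=
  [set a | (a^T *m const_mx 1 : 'M[R]_1) 0 0 = 1].

Definition mv_risk (R : realType) (n : nat) (mu a x : 'cV[R]_n) : R :=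
  2^-1 * (a^T *m (x - mu) *m (x - mu)^T *m a) 0 0.

Definition mv_domain (R : realType) (n : nat) (Sigma : 'M[R]_n) :
    set (R * 'cV[R]_n) :=
  [set p | [/\ 0 < p.1, portfolio p.2 & p.1 * quad_form Sigma p.2 < 1]].

Definition min_variance_portfolio (R : realType) (n : nat) (Sigma : 'M[R]_n) :
    'cV[R]_n :=
  let ones : 'cV[R]_n := const_mx 1 in
  ((ones^T *m invmx Sigma *m ones) 0 0)^-1 *: (invmx Sigma *m ones).

(* A set, so that uniqueness of the minimiser reads arg_inf D f = [set a]. *)
Definition arg_inf (I : Type) (disp : Order.disp_t) (S : porderType disp)
    (D : set I) (f : I -> S) : set I :=
  [set a | D a /\ forall b, D b -> (f a <= f b)%O].

(* lne (ln on \bar R) is used so that an infinite expectation keeps the value +oo *)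
Definition entropic_objective (R : realType) (d : measure_display)
    (T : measurableType d) (P : probability T R) (n : nat)
    (X : {RV P >-> n.-tuple (measurableTypeR R)}) (mu : 'cV[R]_n)
    (theta : R) (a : 'cV[R]_n) : \bar R :=
  ((theta^-1)%:E *
   lne 'E_P[fun w => expR (theta * mv_risk mu a (col_of_tuple (X w)))])%E.

(* Main.v *)
(* For [X ~ N(mu, Sigma)] and [s = a^T Sigma a < 1 / t], multiplying the density
   of [X] by [exp (t V_a)] gives an unnormalised Gaussian density with precision
   matrix [Sigma^-1 - t a a^T], whose determinant is [(1 - t s) / det Sigma].
   The n-dimensional Gaussian integral thus yields
   [E exp (t V_a) = (1 - t s)^(-1/2)], which is increasing in [s].  For [t] of
   either sign, [1 + t V_a <= exp (t V_a)] then forces [E V_a = s / 2].  All three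
   objectives are therefore increasing functions of [s], and [s] is minimised on
   portfolios at [a0 = Sigma^-1 1 / (1^T Sigma^-1 1)] because
   [quad_form Sigma a = quad_form Sigma a0 + quad_form Sigma (a - a0)] there. *)
Require Import Defs.
From HB Require Import structures.
From mathcomp Require Import all_boot all_order all_algebra.
From mathcomp Require Import all_classical all_reals all_analysis.
From mathcomp Require Import measurable_realfun ring lra.

Import Order.TTheory GRing.Theory Num.Theory.
Import numFieldNormedType.Exports.

Local Open Scope classical_set_scope.
Local Open Scope ring_scope.

Set Implicit Arguments.
Unset Strict Implicit.

(** * Determinants of bordered matrices and of rank-one perturbations *)

(** Block elimination of the first column: [C - m^-1 *: (b *m r)] is the Schur complement of the
    pivot [m]. *)
Lemma det_schur (F : fieldType) (n : nat) (m : F) (r : 'rV[F]_n) (b : 'cV[F]_n)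
    (C : 'M[F]_n) : m != 0 ->
  \det (block_mx m%:M r b C : 'M[_]_(1 + n)) = m * \det (C - m^-1 *: (b *m r)).
Proof.
move=> m0.
have -> : block_mx m%:M r b C = block_mx (1%:M : 'M[_]_1) 0 (m^-1 *: b) 1%:M *m
    block_mx m%:M r 0 (C - m^-1 *: (b *m r)).
  rewrite mulmx_block !mul0mx !mulmx0 !mul1mx !addr0 -scalemxAl.
  by rewrite mul_mx_scalar scalerA mulVf// scale1r -scalemxAl addrC subrK.
by rewrite det_mulmx det_lblock det_ublock !det1 !mul1r det_scalar1.
Qed.

(** The matrix with identity diagonal blocks bordered by [v^T] and [u] can be reduced by eliminating
    either block; the two resulting determinants agree. *)
Lemma det_one_sub_rank1 (F : fieldType) (n : nat) (u v : 'cV[F]_n) :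
  \det (1%:M - u *m v^T) = 1 - (v^T *m u) 0 0.
Proof.
have := @det_schur F n 1 v^T u 1%:M (oner_neq0 F).
rewrite invr1 scale1r mul1r => <-.
have -> : block_mx 1%:M v^T u 1%:M = block_mx (1%:M : 'M[_]_1) v^T 0 1%:M *m
    block_mx (1%:M - v^T *m u) 0 u 1%:M.
  by rewrite mulmx_block !mul0mx !mulmx0 !mul1mx !mulmx1 !add0r subrK.
by rewrite det_mulmx det_lblock det_ublock !det1 !mul1r mulr1 det_mx11 !mxE eqxx.
Qed.

(** * Quadratic forms and positive definite matrices *)

Section quadratic_forms.
Context {R : realType}.

Lemma quad_formD n (M : 'M[R]_n) (u v : 'cV_n) : M^T = M ->
  quad_form M (u + v) =
  quad_form M u + (u^T *m M *m v) 0 0 *+ 2 + quad_form M v.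
Proof.
move=> sM; rewrite /quad_form [(u + v)^T]linearD !mulmxDl !mulmxDr.
have -> : (v^T *m M *m u) = (u^T *m M *m v)^T.
  by rewrite !trmx_mul trmxK sM mulmxA.
by rewrite !mxE mulr2n !addrA.
Qed.

Lemma quad_formZ n (M : 'M[R]_n) c (u : 'cV_n) :
  quad_form M (c *: u) = c ^+ 2 * quad_form M u.
Proof.
by rewrite /quad_form [(c *: u)^T]linearZ -scalemxAr -!scalemxAl !mxE mulrA expr2.
Qed.

Lemma quad_form0 n (M : 'M[R]_n) : quad_form M 0 = 0.
Proof. by rewrite /quad_form mulmx0 mxE. Qed.

Lemma quad_form_rank1 n (M : 'M[R]_n) t (a u : 'cV_n) :
  quad_form (M - t *: (a *m a^T)) u = quad_form M u - t * (a^T *m u) 0 0 ^+ 2.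
Proof.
rewrite /quad_form; set w := a^T *m u.
have -> : u^T *m (M - t *: (a *m a^T)) *m u = u^T *m M *m u - t *: (w^T *m w).
  rewrite mulmxBr mulmxBl -scalemxAr -scalemxAl; congr (_ - _ *: _).
  by rewrite /w trmx_mul trmxK !mulmxA.
by move: w (u^T *m M *m u) => w q; rewrite !mxE big_ord1 !mxE expr2.
Qed.

Lemma posdefmx_ge0 n (M : 'M[R]_n) u : posdefmx M -> 0 <= quad_form M u.
Proof.
move=> [_ pM]; have [->|/pM/ltW//] := eqVneq u 0.
by rewrite quad_form0.
Qed.

(** Completes the square in the first coordinate [c]. Both the positivity of Schur complements and
    the Gaussian integral rest on it. *)
Lemma quad_form_schur n (m c : R) (b v : 'cV[R]_n) (C : 'M[R]_n) : m != 0 ->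
  quad_form (block_mx m%:M b^T b C : 'M[_]_(1 + n)) (col_mx c%:M v) =
  m * (c + m^-1 * (b^T *m v) 0 0) ^+ 2 +
  quad_form (C - m^-1 *: (b *m b^T)) v.
Proof.
move=> m0; rewrite quad_form_rank1 /quad_form tr_col_mx mul_row_block mul_row_col.
rewrite tr_scalar_mx !mulmxDl -!scalar_mxM.
have -> : v^T *m b = (b^T *m v)^T by rewrite trmx_mul trmxK.
rewrite mul_scalar_mx -scalemxAl mul_mx_scalar !mxE !eqxx !mulr1n.
set w := \sum_j _; set q := \sum_j _.
by field.
Qed.

Lemma block_symmx n (M : 'M[R]_(1 + n)) : M^T = M ->
  M = block_mx (M 0 0)%:M (dlsubmx M)^T (dlsubmx M) (drsubmx M).
Proof.
move=> sM; rewrite -{1}(submxK M); congr block_mx.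
- apply/matrixP => i j; rewrite !ord1 !mxE/= mulr1n.
  by congr (M _ _); apply/val_inj.
- by rewrite trmx_dlsub sM.
Qed.

Lemma posdefmx_schur n (m : R) (b : 'cV[R]_n) (C : 'M[R]_n) :
  posdefmx (block_mx m%:M b^T b C : 'M[_]_(1 + n)) ->
  0 < m /\ posdefmx (C - m^-1 *: (b *m b^T)).
Proof.
move=> [sM pM].
have m0 : 0 < m.
  have := pM (col_mx 1%:M 0).
  rewrite /quad_form tr_col_mx mul_row_block mul_row_col !trmx0 !mul0mx !mulmx0.
  rewrite !addr0 tr_scalar_mx -!scalar_mxM mxE eqxx mulr1n mul1r mulr1; apply.
  apply/eqP => /(congr1 usubmx); rewrite col_mxKu => /matrixP /(_ 0 0).
  by rewrite !mxE/= mulr1n => /eqP; rewrite oner_eq0.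
split => //; split.
  move: sM; rewrite tr_block_mx => /eq_block_mx[_ _ _ sC].
  by rewrite linearB linearZ/= trmx_mul trmxK sC.
move=> v v0.
(* This first coordinate makes the completed square vanish, leaving the Schur complement at [v]. *)
have := pM (col_mx (- (m^-1 * (b^T *m v) 0 0))%:M v).
rewrite quad_form_schur ?gt_eqF// addNr expr0n/= mulr0 add0r; apply.
by apply: contra_neq v0 => /(congr1 dsubmx); rewrite col_mxKd linear0.
Qed.

(** By induction on the dimension, the determinant is the product of the pivots of the successive
    Schur complements. *)
Lemma posdefmx_det_gt0 n (M : 'M[R]_n) : posdefmx M -> 0 < \det M.
Proof.
elim: n M => [|n ih] M pM; first by rewrite det_mx00.
have sM := @block_symmx n M (proj1 pM); rewrite sM in pM.
have [m0 pS] := posdefmx_schur pM.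
by rewrite [M]sM det_schur ?gt_eqF// mulr_gt0 ?ih.
Qed.

Lemma posdefmx_unit n (M : 'M[R]_n) : posdefmx M -> M \in unitmx.
Proof. by move=> /posdefmx_det_gt0 M0; rewrite unitmxE unitfE gt_eqF. Qed.

(** The form of [invmx M] at [v] is the form of [M] at [invmx M *m v]. *)
Lemma posdefmx_inv n (M : 'M[R]_n) : posdefmx M -> posdefmx (invmx M).
Proof.
move=> pM; have uM := posdefmx_unit pM; have [sM qM] := pM.
split=> [|v v0]; first by rewrite trmx_inv sM.
have := qM (invmx M *m v).
rewrite /quad_form trmx_mul trmx_inv sM mulmxKV// mulmxA; apply.
by apply: contra_neq v0 => /(congr1 (mulmx M)); rewrite mulKVmx// mulmx0.
Qed.

(* Cauchy-Schwarz, from the nonnegativity of [M] at [invmx M v - t (a^T v) a]. *)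
Lemma posdefmx_inv_sub_rank1 n (M : 'M[R]_n) t (a : 'cV_n) :
  posdefmx M -> t * quad_form M a < 1 -> posdefmx (invmx M - t *: (a *m a^T)).
Proof.
move=> pM ts; have uM := posdefmx_unit pM; have [sM qM] := pM.
have pI := posdefmx_inv pM; have [sI qI] := pI.
split=> [|v v0]; first by rewrite linearB linearZ/= trmx_mul trmxK sI.
rewrite quad_form_rank1; set w := (a^T *m v) 0 0.
have q0 := qI _ v0.
have [t0|t0] := lerP t 0.
  by apply: lt_le_trans q0 _; rewrite lerBrDr gerDl mulr_le0_ge0// sqr_ge0.
have [->|w0] := eqVneq w 0; first by rewrite expr0n mulr0 subr0.
have := @posdefmx_ge0 _ M (invmx M *m v + (- (t * w)) *: a) pM.
rewrite quad_formD// quad_formZ.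
have -> : quad_form M (invmx M *m v) = quad_form (invmx M) v.
  by rewrite /quad_form trmx_mul trmx_inv sM mulmxKV// mulmxA.
have -> : ((invmx M *m v)^T *m M *m (- (t * w) *: a)) 0 0 = - (t * w) * w.
  rewrite trmx_mul trmx_inv sM mulmxKV// -scalemxAr mxE; congr (_ * _).
  have -> : v^T *m a = (a^T *m v)^T by rewrite trmx_mul trmxK.
  by rewrite mxE.
move=> h.
(* With q = v^T M^-1 v and s = a^T M a, [h] says q >= 2 t w^2 - t^2 w^2 s, hence q - t w^2 >= t w^2
   (1 - t s) > 0. *)
have : 0 < (t * w ^+ 2) * (1 - t * quad_form M a).
  by rewrite mulr_gt0 ?subr_gt0// mulr_gt0// exprn_even_gt0.
rewrite mulr2n in h.
by nra.
Qed.

(** Factoring out [invmx M] leaves the identity minus a rank-one matrix. *)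
Lemma det_inv_sub_rank1 n (M : 'M[R]_n) t (a : 'cV_n) : M \in unitmx ->
  \det (invmx M - t *: (a *m a^T)) = (\det M)^-1 * (1 - t * quad_form M a).
Proof.
move=> uM.
have -> : invmx M - t *: (a *m a^T) = invmx M *m (1%:M - (t *: (M *m a)) *m a^T).
  by rewrite mulmxBr mulmx1 -scalemxAl -scalemxAr !mulmxA mulVmx// mul1mx.
rewrite det_mulmx det_inv det_one_sub_rank1 -scalemxAr mxE /quad_form mulmxA.
by [].
Qed.

End quadratic_forms.

(** * The Gaussian integral in dimension n *)

Section gaussian_integral.
Context {R : realType}.

Lemma measurable_mulmx_col n (c : 'rV[R]_n) (mu : 'cV[R]_n) :
  measurable_fun [set: n.-tuple (measurableTypeR R)]
    (fun x => (c *m (col_of_tuple x - mu)) 0 0).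
Proof.
under eq_fun do rewrite mxE.
apply: measurable_sum => i; under eq_fun do rewrite !mxE.
apply: measurable_funM => //; apply: measurable_funB => //.
exact: measurable_tnth.
Qed.

Lemma measurable_quad_form n (M : 'M[R]_n) (mu : 'cV[R]_n) :
  measurable_fun [set: n.-tuple (measurableTypeR R)]
    (fun x => quad_form M (col_of_tuple x - mu)).
Proof.
(* [e i] extracts the i-th coordinate, so the quadratic form becomes a sum of products of two affine
   functions of [x]. *)
pose e i : 'rV[R]_n := row i 1%:M.
have -> : (fun x : n.-tuple (measurableTypeR R) =>
      quad_form M (col_of_tuple x - mu)) = (fun x => \sum_i
        (e i *m (col_of_tuple x - mu)) 0 0 * (row i M *m (col_of_tuple x - mu)) 0 0).
  apply/funext => x; rewrite /quad_form -mulmxA mxE; apply: eq_bigr => i _.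
  by rewrite /e -!row_mul mul1mx !mxE.
by apply: measurable_sum => i; apply: measurable_funM;
  exact: measurable_mulmx_col.
Qed.

(** Up to its peak value, the integrand is the normal density of mean [- c] and variance [m^-1], of
    total mass 1. *)
Lemma integral_gauss (m c : R) : 0 < m ->
  (\int[lebesgue_measure]_x (expR (- (m * (x + c) ^+ 2 / 2)))%:E =
   (Num.sqrt (2 * pi / m))%:E)%E.
Proof.
move=> m0; pose s := Num.sqrt m^-1.
have s0 : s != 0 by rewrite gt_eqF// sqrtr_gt0 invr_gt0.
have s2 : s ^+ 2 = m^-1 by rewrite sqr_sqrtr// invr_ge0 ltW.
have p0 := normal_peak_gt0 s0.
transitivity (\int[lebesgue_measure]_x
    ((normal_peak s)^-1%:E * (normal_pdf (- c) s x)%:E))%E.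
  apply: eq_integral => x _; rewrite normal_pdfE// -EFinM mulKf ?gt_eqF//.
  by rewrite /normal_fun s2 opprK; congr (expR _)%:E; field; rewrite gt_eqF.
rewrite ge0_integralZl//=.
- rewrite integral_normal_pdf mule1 /normal_peak invrK s2.
  by congr (Num.sqrt _)%:E; rewrite -mulr_natr; field; rewrite gt_eqF.
- by apply/measurable_EFinP; exact: measurable_normal_pdf.
- by move=> x _; rewrite lee_fin normal_pdf_ge0.
- by rewrite lee_fin invr_ge0 ltW.
Qed.

(** Tonelli with the first coordinate innermost, so that a square completed in that coordinate is
    integrated first. *)
Lemma ge0_integral_lebesgue_tupleS n (f : n.+1.-tuple (measurableTypeR R) -> \bar R) :
  measurable_fun [set: _] f -> (forall x, 0 <= f x)%E ->
  (\int[lebesgue_measure_tuple R n.+1]_x f x =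
   \int[lebesgue_measure_tuple R n]_y \int[lebesgue_measure]_x
     f (tuple_cons (x, y)))%E.
Proof.
move=> mf f0.
have := @ge0_integral_pushforward _ _ _ _ R _ (@measurable_tuple_cons R n)
  (@lebesgue_measure R \x lebesgue_measure_tuple R n)%E setT f measurableT mf
  (fun x _ => f0 x).
rewrite preimage_setT fubini_tonelli2//=.
by apply: measurableT_comp => //; exact: measurable_tuple_cons.
Qed.

Lemma col_of_tuple_cons n (x : R) (y : n.-tuple R) :
  col_of_tuple (tuple_cons (x, y)) = col_mx (x%:M : 'M[_]_1) (col_of_tuple y).
Proof.
apply/matrixP => i j; rewrite ord1 !mxE.
case: splitP => k ik; rewrite !mxE.
  by rewrite ord1 mulr1n (_ : i = ord0)//; apply/val_inj; rewrite /= ik ord1.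
by rewrite (_ : i = lift ord0 k) ?tnthS//; apply/val_inj; rewrite /= ik.
Qed.

Lemma col_of_tuple_cons_sub n (x : R) (y : n.-tuple R) (mu : 'cV[R]_(1 + n)) :
  col_of_tuple (tuple_cons (x, y)) - mu =
  col_mx (x - mu 0 0)%:M (col_of_tuple y - dsubmx mu).
Proof.
transitivity (col_mx (x%:M : 'M[_]_1) (col_of_tuple y) - mu).
  by rewrite -col_of_tuple_cons.
have <- : x%:M - usubmx mu = (x - mu 0 0)%:M.
  apply/matrixP => i j; rewrite !ord1 !mxE/= !mulr1n.
  by congr (_ - mu _ _); exact/val_inj.
by rewrite -[mu in LHS]vsubmxK opp_col_mx add_col_mx.
Qed.

Lemma measurable_gauss_quad_form n (M : 'M[R]_n) (mu : 'cV[R]_n) :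
  measurable_fun [set: n.-tuple (measurableTypeR R)]
    (fun x => (expR (- (quad_form M (col_of_tuple x - mu) / 2)))%:E).
Proof.
apply/measurable_EFinP; apply: measurableT_comp => //.
apply: measurableT_comp => //; apply: measurable_funM => //.
exact: measurable_quad_form.
Qed.

(* Complete the square in the first coordinate: the remaining coordinates see
   the Schur complement of [M 0 0]. *)
Lemma integral_gauss_quad_form n (M : 'M[R]_n) (mu : 'cV[R]_n) : posdefmx M ->
  (\int[lebesgue_measure_tuple R n]_x
     (expR (- (quad_form M (col_of_tuple x - mu) / 2)))%:E =
   (Num.sqrt ((2 * pi) ^+ n / \det M))%:E)%E.
Proof.
elim: n M mu => [|n ih] M mu pM.
  rewrite /= integral_dirac//; last exact: measurable_gauss_quad_form.
  rewrite diracE mem_set// mul1e /quad_form !mxE big_ord0 mul0r oppr0.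
  by rewrite expR0 det_mx00 expr0 divr1 sqrtr1.
have sM := @block_symmx _ n M (proj1 pM); rewrite sM in pM.
have [m0 pS] := posdefmx_schur pM; have dS := posdefmx_det_gt0 pS.
rewrite [M]sM; set m := M 0 0 in m0 pS dS *.
move: (@dlsubmx R 1 n 1 n M) (@drsubmx R 1 n 1 n M) pS dS => b C pS dS.
rewrite det_schur ?gt_eqF//.
pose nu : 'cV[R]_n := dsubmx (mu : 'cV[R]_(1 + n)).
rewrite ge0_integral_lebesgue_tupleS; last 2 first.
- exact: measurable_gauss_quad_form.
- by move=> x; rewrite lee_fin expR_ge0.
transitivity (\int[lebesgue_measure_tuple R n]_y ((Num.sqrt (2 * pi / m))%:E *
    (expR (- (quad_form (C - m^-1 *: (b *m b^T)) (col_of_tuple y - nu) / 2)))%:E))%E.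
  apply: eq_integral => y _.
  set v := col_of_tuple y - nu.
  (* The shift [c] depends on [y], but the one-dimensional integral does not depend on [c]; it
     therefore leaves the outer integral as a constant. *)
  pose c := m^-1 * (b^T *m v) 0 0 - mu 0 0.
  transitivity (\int[lebesgue_measure]_x
      ((expR (- (quad_form (C - m^-1 *: (b *m b^T)) v / 2)))%:E *
       (expR (- (m * (x + c) ^+ 2 / 2)))%:E))%E.
    apply: eq_integral => x _; rewrite -EFinM -expRD.
    have -> : col_of_tuple (tuple_cons (x, y)) - mu = col_mx (x - mu 0 0)%:M v.
      exact: col_of_tuple_cons_sub.
    rewrite quad_form_schur ?gt_eqF//; congr (expR _)%:E.
    by rewrite /c; set q := quad_form _ _; set w := (_ *m _) _ _; field; rewrite gt_eqF.
  rewrite ge0_integralZl//=.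
  - by rewrite integral_gauss// muleC.
  - apply/measurable_EFinP; apply: measurableT_comp => //.
    apply: measurableT_comp => //; apply: measurable_funM => //.
    apply: measurable_funM => //; apply: measurable_funX.
    exact: measurable_funD.
rewrite ge0_integralZl//=.
- rewrite ih// -EFinM -sqrtrM ?divr_ge0 ?mulr_ge0 ?pi_ge0 ?ltW//.
  by congr (Num.sqrt _)%:E; rewrite exprS; field; rewrite !gt_eqF.
- exact: measurable_gauss_quad_form.
Qed.

End gaussian_integral.

(** * Integration against a measure given by a density *)

Section density.
Local Open Scope ereal_scope.
Context d (T : measurableType d) (R : realType).
Import HBNNSimple.

(** The hypothesis on [nu] is the case of indicators; linearity gives simple functions, and monotone
    convergence along [h] gives [f]. *)
Lemma ge0_integral_density (mu nu : {measure set T -> \bar R}) (p : T -> R)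
    (f : T -> \bar R) :
  measurable_fun [set: T] p -> (forall x, 0 <= p x)%R ->
  (forall A, measurable A -> nu A = \int[mu]_(x in A) (p x)%:E) ->
  measurable_fun [set: T] f -> (forall x, 0 <= f x) ->
  \int[nu]_x f x = \int[mu]_x (f x * (p x)%:E).
Proof.
move=> mp p0 nuE mf f0; pose h := nnsfun_approx measurableT mf.
have hcvg x : EFin \o h ^~ x @ \oo --> f x by exact: cvg_nnsfun_approx.
transitivity (limn (fun n => \int[nu]_x (h n x)%:E)).
  rewrite -monotone_convergence//.
  - by apply: eq_integral => x _; apply/esym/cvg_lim => //; exact: hcvg.
  - by move=> n; exact/measurable_EFinP.
  - by move=> n x _; rewrite lee_fin.
  - by move=> x _ a b ab; rewrite lee_fin; exact/lefP/nd_nnsfun_approx.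
transitivity (limn (fun n => \int[mu]_x ((h n x)%:E * (p x)%:E))); last first.
  rewrite -monotone_convergence//.
  - apply: eq_integral => x _; apply/cvg_lim => //; apply: cvgeZr => //.
    exact: hcvg.
  - move=> n; apply/measurable_EFinP => /=.
    exact: measurable_funM.
  - by move=> n x _; rewrite lee_fin mulr_ge0.
  - move=> x _ a b ab; rewrite lee_fin ler_wpM2r//.
    exact/lefP/nd_nnsfun_approx.
congr (limn _); apply/funext => n.
have mr r : measurable (h n @^-1` [set r]) by [].
transitivity (\sum_(r \in range (h n)) r%:E * nu (h n @^-1` [set r])).
  by rewrite integralT_nnsfun sintegralE.
under [RHS]eq_integral => x _.
  rewrite fimfunE -fsumEFin// ge0_mule_fsuml; last first.
    by move=> y; exact: nnfun_muleindic_ge0.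
  over.
rewrite ge0_integral_fsum//=.
- apply: eq_fsbigr => r _.
  (* A negative [r] has an empty fibre under [h n], so both sides vanish. *)
  have [r0|r0] := ltP r 0%R.
    rewrite preimage_nnfun0// measure0 mule0 integral0_eq// => x _.
    by rewrite indic0 mulr0 mul0e.
  rewrite nuE// -ge0_integralZl//.
    rewrite integral_mkcond; apply: eq_integral => x _.
    rewrite patchE indicE; case: ifPn => _; first by rewrite mulr1.
    by rewrite mulr0 mul0e.
  - by apply/measurable_EFinP; exact: measurable_funTS.
  - by move=> x _; rewrite lee_fin.
- move=> r; apply: emeasurable_funM; last exact/measurable_EFinP.
  by apply/measurable_EFinP; exact: measurable_funM.
- by move=> r x _; rewrite mule_ge0 ?lee_fin// -lee_fin nnfun_muleindic_ge0.
Qed.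

End density.

(* The hypothesis says that [t |-> (1 + t * e) * sqrt (1 - t * s)] is maximal
   at [t = 0], so its derivative [e - s / 2] vanishes there. *)
Lemma half_slope_of_inv_sqrt_ge (R : realType) (s e : R) : 0 <= s -> 0 <= e ->
  (forall t, t * s < 1 -> 1 + t * e <= (Num.sqrt (1 - t * s))^-1) -> e = s / 2.
Proof.
(* [D] is the linear coefficient of (1 + t e)^2 (1 - t s); for t <= 1 the terms of higher order are
   at least - K t^2. *)
move=> s0 e0 h; pose D := 2 * e - s; pose K := 2 * e * s + e ^+ 2 * s.
suff : D = 0 by rewrite /D; lra.
apply/eqP/negPn/negP => D0.
have K0 : 0 <= K by rewrite /K addr_ge0 ?mulr_ge0 ?sqr_ge0.
(* [N] exceeds [K], for the final contradiction, and also |D| (1 + e + s), so that t = D / N makes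
   |t|, |t e| and |t s| smaller than 1. *)
pose N := 1 + K + (2 * e + s) * (1 + e + s).
have es0 : 0 <= (2 * e + s) * (1 + e + s) by rewrite mulr_ge0 ?addr_ge0 ?mulr_ge0.
have N0 : 0 < N by rewrite /N; lra.
pose t := D / N.
have small c : 0 <= c -> c <= 1 + e + s -> `|t * c| < 1.
  move=> c0 c1; rewrite /t mulrAC normrM normfV (gtr0_norm N0) ltr_pdivrMr// mul1r.
  rewrite normrM (ger0_norm c0); apply: le_lt_trans (_ : (2 * e + s) * (1 + e + s) < N).
    apply: ler_pM => //; rewrite /D (le_trans (ler_normB _ _))// !ger0_norm//.
    by rewrite mulr_ge0.
  by rewrite /N; lra.
have /ltr_normlP[t1 t1'] : `|t * 1| < 1 by apply: small; lra.
have /ltr_normlP[te te'] : `|t * e| < 1 by apply: small; lra.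
have /ltr_normlP[ts ts'] : `|t * s| < 1 by apply: small; lra.
have u0 : 0 < 1 - t * s by lra.
have sq : (1 + t * e) ^+ 2 * (1 - t * s) <= 1.
  have := h _ ts'; rewrite -[X in X <= _]mulr1 -ler_pdivlMl; last by lra.
  move=> h1; rewrite -ler_pdivlMr// div1r -(sqr_sqrtr (ltW u0)) -exprVn.
  rewrite ler_sqr ?nnegrE ?invr_ge0 ?sqrtr_ge0//; last by lra.
  exact: h.
have tD : t * D <= t ^+ 2 * K.
  have : t ^+ 2 * (2 * e * s - e ^+ 2 + t * e ^+ 2 * s) <= t ^+ 2 * K.
    rewrite ler_wpM2l ?sqr_ge0// /K.
    have : t * (e ^+ 2 * s) <= 1 * (e ^+ 2 * s).
      by rewrite ler_wpM2r ?mulr_ge0 ?sqr_ge0//; lra.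
    by have := sqr_ge0 e; lra.
  by move: sq; rewrite /D; lra.
have Dt : D = t * N by rewrite /t divfK ?gt_eqF.
have t2 : 0 < t ^+ 2.
  by rewrite exprn_even_gt0//=; apply: contra_neq D0 => t0; rewrite Dt t0 mul0r.
(* Substituting D = t N into [tD] gives N <= K, which the choice of [N] excludes. *)
have : t ^+ 2 * N <= t ^+ 2 * K by move: tD; rewrite Dt; lra.
by rewrite ler_pM2l// /N; lra.
Qed.

(** Strict domination of all competitors yields existence and uniqueness at once; each minimisation
    claim is reduced to it. *)
Lemma arg_inf_set1 (I : Type) (disp : Order.disp_t) (S : porderType disp)
    (D : set I) (f : I -> S) (a : I) :
  D a -> (forall b, D b -> b <> a -> (f a < f b)%O) -> arg_inf D f = [set a].
Proof.
move=> Da fa; apply/seteqP; split=> [b [Db fb]|_ ->].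
  apply: contrapT => ba; have := fa _ Db ba.
  by rewrite lt_leAnge fb// andbF.
split=> // b Db; have [->//|ba] := pselect (b = a).
exact/ltW/fa.
Qed.

(** * Optimality of the minimum-variance portfolio for the variance *)

Section min_variance_portfolio.
Context {R : realType} {n : nat} {Sigma : 'M[R]_n}.
Hypotheses (n_ge1 : (1 <= n)%N) (Sigma_pd : posdefmx Sigma).
Let ones : 'cV[R]_n := const_mx 1.

Let k_gt0 : 0 < (ones^T *m invmx Sigma *m ones) 0 0.
Proof.
apply: (posdefmx_inv Sigma_pd).2; apply/eqP => /matrixP.
(* Since n >= 1, the all-ones vector has an entry, equal to 1, and is nonzero. *)
by move=> /(_ (Ordinal n_ge1) 0); rewrite !mxE => /eqP; rewrite oner_eq0.
Qed.

Let sI : (invmx Sigma)^T = invmx Sigma.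
Proof. exact: (posdefmx_inv Sigma_pd).1. Qed.

Lemma portfolio_min_variance : portfolio (min_variance_portfolio Sigma).
Proof.
rewrite /portfolio /= /min_variance_portfolio -/ones.
rewrite [(_ *: _)^T]linearZ/= trmx_mul sI -scalemxAl mxE mulVf//.
by rewrite gt_eqF.
Qed.

Lemma quad_form_min_variance (b : 'cV[R]_n) : portfolio b ->
  b <> min_variance_portfolio Sigma ->
  quad_form Sigma (min_variance_portfolio Sigma) < quad_form Sigma b.
Proof.
move=> pb; set a := min_variance_portfolio Sigma => /eqP ba.
have [sS qS] := Sigma_pd.
have -> : b = a + (b - a) by rewrite addrC subrK.
rewrite quad_formD//.
(* a^T Sigma is a multiple of 1^T, and 1^T (b - a) = 1 - 1 = 0 for two portfolios. *)
have -> : (a^T *m Sigma *m (b - a)) 0 0 = 0.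
  have o1 (c : 'cV[R]_n) : portfolio c -> (ones^T *m c) 0 0 = 1.
    rewrite /portfolio/= -/ones => <-.
    by rewrite -{2}(trmxK ones) -trmx_mul [in RHS]mxE.
  rewrite {1}/a /min_variance_portfolio -/ones.
  rewrite [(_ *: _)^T]linearZ/= trmx_mul sI -!scalemxAl mulmxKV ?posdefmx_unit//.
  rewrite mulmxBr; have := o1 _ pb; have := o1 _ portfolio_min_variance.
  rewrite -/a; move: (ones^T *m a) (ones^T *m b) => u v uE vE.
  by rewrite !mxE uE vE subrr mulr0.
by rewrite mul0rn addr0 ltrDl qS// subr_eq0.
Qed.

End min_variance_portfolio.

(** * Exponential moments and mean of the risk under the normal law *)

Lemma mv_riskE (R : realType) n (mu a x : 'cV[R]_n) :
  mv_risk mu a x = (a^T *m (x - mu)) 0 0 ^+ 2 / 2.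
Proof.
rewrite /mv_risk -(mulmxA _ (x - mu)^T) mulrC.
have -> : (x - mu)^T *m a = (a^T *m (x - mu))^T by rewrite trmx_mul trmxK.
by move: (a^T *m (x - mu)) => w; rewrite !mxE big_ord1 !mxE expr2.
Qed.

Section mvnormal_risk.
Context (R : realType) (d : measure_display) (T : measurableType d)
  (P : probability T R) (n : nat) (mu : 'cV[R]_n) (Sigma : 'M[R]_n)
  (X : {RV P >-> n.-tuple (measurableTypeR R)}).
Hypotheses (Sigma_pd : posdefmx Sigma) (HX : mvnormal X mu Sigma).

Lemma mv_risk_ge0 (a x : 'cV[R]_n) : 0 <= mv_risk mu a x.
Proof. by rewrite mv_riskE mulr_ge0 ?sqr_ge0. Qed.

Lemma measurable_mv_risk a :
  measurable_fun [set: n.-tuple (measurableTypeR R)]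
    (fun x => mv_risk mu a (col_of_tuple x)).
Proof.
under eq_fun do rewrite mv_riskE.
apply: measurable_funM => //; apply: measurable_funX.
exact: measurable_mulmx_col.
Qed.

Lemma measurable_mvnormal_pdf :
  measurable_fun [set: n.-tuple (measurableTypeR R)]
    (fun x => mvnormal_pdf mu Sigma (col_of_tuple x)).
Proof.
apply: measurable_funM => //; apply/measurable_EFinP.
exact: measurable_gauss_quad_form.
Qed.

Lemma ge0_integral_mvnormal (f : n.-tuple (measurableTypeR R) -> \bar R) :
  measurable_fun [set: _] f -> (forall x, 0 <= f x)%E ->
  (\int[P]_w f (X w) = \int[lebesgue_measure_tuple R n]_x
     (f x * (mvnormal_pdf mu Sigma (col_of_tuple x))%:E))%E.
Proof.
move=> mf f0; rewrite -[LHS]/(\int[P]_w (f \o X) w)%E.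
rewrite -ge0_integral_distribution//; apply: ge0_integral_density => //.
- exact: measurable_mvnormal_pdf.
- by move=> x; rewrite divr_ge0 ?expR_ge0 ?sqrtr_ge0.
Qed.

(* The tilted density is, up to a constant, the Gaussian one with precision
   matrix [invmx Sigma - t *: (a *m a^T)]. *)
Lemma expectation_expR_mv_risk t (a : 'cV[R]_n) : t * quad_form Sigma a < 1 ->
  'E_P[fun w => expR (t * mv_risk mu a (col_of_tuple (X w)))]%E =
  ((Num.sqrt (1 - t * quad_form Sigma a))^-1)%:E.
Proof.
move=> ts; rewrite expectation.unlock.
have mE : measurable_fun [set: n.-tuple (measurableTypeR R)]
    (fun x => (expR (t * mv_risk mu a (col_of_tuple x)))%:E).
  apply/measurable_EFinP; apply: measurableT_comp => //.
  by apply: measurable_funM => //; exact: measurable_mv_risk.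
rewrite (@ge0_integral_mvnormal (fun x =>
  (expR (t * mv_risk mu a (col_of_tuple x)))%:E))//.
have dS := posdefmx_det_gt0 Sigma_pd.
pose M := invmx Sigma - t *: (a *m a^T).
pose c := Num.sqrt ((2 * pi) ^+ n * \det Sigma).
have D0 : 0 < (2 * pi) ^+ n * \det Sigma.
  by rewrite mulr_gt0// exprn_gt0// mulr_gt0 ?pi_gt0.
transitivity (\int[lebesgue_measure_tuple R n]_x (c^-1%:E *
    (expR (- (quad_form M (col_of_tuple x - mu) / 2)))%:E))%E.
  apply: eq_integral => x _; rewrite -!EFinM /mvnormal_pdf -/c; congr EFin.
  rewrite mulrA -expRD [RHS]mulrC quad_form_rank1 mv_riskE; congr (expR _ * _).
  by lra.
rewrite ge0_integralZl//=; last 2 first.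
- exact: measurable_gauss_quad_form.
- by rewrite lee_fin invr_ge0 sqrtr_ge0.
rewrite integral_gauss_quad_form; last exact: posdefmx_inv_sub_rank1.
rewrite det_inv_sub_rank1 ?posdefmx_unit// -EFinM; congr EFin.
(* The Gaussian integral equals [c] / sqrt (1 - t s), with s = a^T Sigma a; the normalising constant
   [c] of the density cancels. *)
rewrite invfM invrK mulrA [in LHS]sqrtrM ?ltW// -/c mulrA mulVf ?gt_eqF ?sqrtr_gt0//.
by rewrite mul1r sqrtrV// subr_ge0 ltW.
Qed.

(** The mean is read off the exponential moments around t = 0. It stays in the extended reals until
    it is shown to be finite. *)
Lemma expectation_mv_risk (a : 'cV[R]_n) :
  'E_P[fun w => mv_risk mu a (col_of_tuple (X w))]%E =
  (quad_form Sigma a / 2)%:E.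
Proof.
set s := quad_form Sigma a; have s0 : 0 <= s by exact: posdefmx_ge0.
pose V w := mv_risk mu a (col_of_tuple (X w)).
have V0 w : 0 <= V w by exact: mv_risk_ge0.
have mV : measurable_fun setT V.
  exact: (measurableT_comp (measurable_mv_risk a)).
have mgf t : t * s < 1 ->
    (\int[P]_w (expR (t * V w))%:E = ((Num.sqrt (1 - t * s))^-1)%:E)%E.
  by move=> ts; rewrite -expectation_expR_mv_risk// expectation.unlock.
have mexp t : measurable_fun setT (fun w => (expR (t * V w))%:E).
  apply/measurable_EFinP; apply: measurableT_comp => //.
  exact: measurable_funM.
rewrite expectation.unlock -[LHS]/(\int[P]_w (V w)%:E)%E; set e := LHS.
have e0 : (0 <= e)%E by apply: integral_ge0 => w _; rewrite lee_fin.
have intZ (t : R) : 0 <= t -> (\int[P]_w (t * V w)%:E = t%:E * e)%E.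
  move=> t0; rewrite /e -ge0_integralZl//.
  - exact/measurable_EFinP.
  - by move=> w _; rewrite lee_fin.
have int1 : (\int[P]_w cst 1 w = 1)%E.
  by rewrite integral_cst// mul1e; exact: probability_setT.
have pos t : 0 <= t -> t * s < 1 ->
    (1 + t%:E * e <= ((Num.sqrt (1 - t * s))^-1)%:E)%E.
  move=> t0 ts; rewrite -mgf// -intZ// -int1 -ge0_integralD//; last 2 first.
  - by move=> w _; rewrite lee_fin mulr_ge0.
  - by apply/measurable_EFinP; exact: measurable_funM.
  apply: ge0_le_integral => //.
  - by move=> w _; rewrite adde_ge0// lee_fin mulr_ge0.
  - apply: emeasurable_funD => //.
    by apply/measurable_EFinP; exact: measurable_funM.
  - by move=> w _; rewrite -EFinD lee_fin expR_ge1Dx.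
(* For t <= 0 the term t V is moved to the other side, so that all integrands remain nonnegative. *)
have neg t : t <= 0 ->
    (1 <= ((Num.sqrt (1 - t * s))^-1)%:E + (- t)%:E * e)%E.
  move=> t0; have ts : t * s < 1.
    by apply: le_lt_trans ltr01; rewrite mulr_le0_ge0.
  rewrite -mgf// -intZ ?oppr_ge0// -int1 -ge0_integralD//; last 2 first.
  - by move=> w _; rewrite lee_fin mulr_ge0// oppr_ge0.
  - by apply/measurable_EFinP; exact: measurable_funM.
  apply: ge0_le_integral => //.
  - apply: emeasurable_funD => //.
    by apply/measurable_EFinP; exact: measurable_funM.
  - move=> w _; rewrite -EFinD lee_fin /= mulNr lerBrDr.
    exact: expR_ge1Dx.
(* One t > 0 with t s < 1 suffices, since [pos] then bounds t e by a real number; 1 / (1 + s) is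
   such a t. *)
have efin : e \is a fin_num.
  rewrite ge0_fin_numE//; pose t := (1 + s)^-1.
  have t0 : 0 < t by rewrite invr_gt0 ltr_pwDl.
  have ts : t * s < 1 by rewrite mulrC ltr_pdivrMr ?ltr_pwDl// mul1r ltrDr.
  rewrite ltey; apply: contraTneq (pos _ (ltW t0) ts) => ->.
  by rewrite gt0_muley ?lte_fin.
move: e0 pos neg; rewrite -(fineK efin); move: (fine e) => r r0 pos neg.
congr EFin; apply: half_slope_of_inv_sqrt_ge => // t ts.
have [t0|/ltW t0] := lerP 0 t.
  by have := pos _ t0 ts; rewrite -EFinM -EFinD lee_fin.
by have := neg _ t0; rewrite -EFinM -EFinD lee_fin mulNr lerBrDr.
Qed.

Lemma entropic_objectiveE theta (a : 'cV[R]_n) : theta * quad_form Sigma a < 1 ->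
  entropic_objective X mu theta a =
  (theta^-1 * ln (Num.sqrt (1 - theta * quad_form Sigma a))^-1)%:E.
Proof.
move=> ts; rewrite /entropic_objective expectation_expR_mv_risk//.
by rewrite lne_EFin// invr_gt0 sqrtr_gt0 subr_gt0.
Qed.

(** The objective is - ln (1 - theta s) / (2 theta), strictly increasing in the variance s; [a]
    inherits the domain bound from [b]. *)
Lemma entropic_objective_lt theta (a b : 'cV[R]_n) : 0 < theta ->
  theta * quad_form Sigma b < 1 -> quad_form Sigma a < quad_form Sigma b ->
  (entropic_objective X mu theta a < entropic_objective X mu theta b)%E.
Proof.
move=> t0 tb ab; have tab : theta * quad_form Sigma a < theta * quad_form Sigma b.
  by rewrite ltr_pM2l.
have ta := lt_trans tab tb.
rewrite !entropic_objectiveE// lte_fin ltr_pM2l ?invr_gt0//.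
rewrite ltr_ln ?posrE ?invr_gt0 ?sqrtr_gt0 ?subr_gt0//.
by rewrite ltf_pV2 ?posrE ?sqrtr_gt0 ?subr_gt0// ltr_sqrt ?subr_gt0// ltrD2l ltrN2.
Qed.

End mvnormal_risk.

(** * The entropic, quadratic and nominal problems share one minimiser *)

Unset Implicit Arguments.
Set Strict Implicit.

Theorem proposition11 (R : realType) (d : measure_display) (T : measurableType d)
    (P : probability T R) (n : nat) (n_ge1 : (1 <= n)%N)
    (mu : 'cV[R]_n) (Sigma : 'M[R]_n) (Sigma_pd : posdefmx Sigma)
    (X : {RV P >-> n.-tuple (measurableTypeR R)}) (HX : mvnormal X mu Sigma)
    (theta : R) (theta_gt0 : 0 < theta)
    (theta_adm : exists a : 'cV[R]_n, mv_domain Sigma (theta, a)) :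
  [/\ arg_inf [set a | mv_domain Sigma (theta, a)] (entropic_objective X mu theta)
        = arg_inf (@portfolio R n) (quad_form Sigma),
      arg_inf [set a | mv_domain Sigma (theta, a)] (entropic_objective X mu theta)
        = [set min_variance_portfolio Sigma] &
      arg_inf (@portfolio R n)
          (fun a => 'E_P[fun w => mv_risk mu a (col_of_tuple (X w))]%E)
        = [set min_variance_portfolio Sigma]].
Proof.
have pa := portfolio_min_variance n_ge1 Sigma_pd.
have qa := quad_form_min_variance n_ge1 Sigma_pd.
have -> : arg_inf (@portfolio R n) (quad_form Sigma) =
    [set min_variance_portfolio Sigma] by exact: arg_inf_set1.
have entropic : arg_inf [set a | mv_domain Sigma (theta, a)]
    (entropic_objective X mu theta) = [set min_variance_portfolio Sigma].
  apply: arg_inf_set1 => /=.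
    (* The minimum-variance portfolio has at most the variance of the admissible [a], so it lies in
       the domain too. *)
    have [a [_ /= a1 ts]] := theta_adm; split=> //=.
    have [<-//|ne] := pselect (a = min_variance_portfolio Sigma).
    by apply: le_lt_trans ts; rewrite ler_pM2l// ltW// qa.
  move=> b [_ /= pb ts] ne.
  by apply: (entropic_objective_lt Sigma_pd HX) => //; exact: qa.
split=> //; apply: arg_inf_set1 => // b pb ne.
by rewrite !(expectation_mv_risk Sigma_pd HX) lte_fin ltr_pM2r// qa.
Qed.
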